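(* Put, for all $\beta, L_1, L_2, L_3 > 0$, $$\Theta(\beta,L_1,L_2,L_3):=(L_1+L_2) \left(L_3 + \frac{L_1+L_2+2\beta L_3 + \sqrt{L_1^2 + L_2^2 + 2L_1L_2 + 8\beta L_1L_3 + 4\beta L_2L_3}}{2\beta}\right).$$ Let $X$ be a real Hilbert space. Let $\beta, L_1, L_2, L_3 > 0$ and let $A: X \to X$ be $\beta$-cocoercive. Let $b, c \in X$ with $\|b\|\leq L_1$, $\|c\|\leq L_2$ and $\|Ab\| \leq L_3$. Then for all $a \in X$, $$\langle a-c,Ab-Aa \rangle \leq \Theta(\beta,L_1,L_2,L_3).$$
   Context: For $\beta > 0$, a (not necessarily linear) mapping $A:X \to X$ on a Hilbert space $X$ is $\beta$-cocoercive if for all $x, y \in X$, $\langle x-y,Ax-Ay \rangle \geq \beta\|Ax-Ay\|^2$. *)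

(* Defs.v *)
From HB Require Import structures.
From mathcomp Require Import all_boot all_order all_algebra sesquilinear.
From mathcomp Require Import all_classical all_reals topology normedtype.

Set Implicit Arguments.
Unset Strict Implicit.
Unset Printing Implicit Defensive.

Import Order.TTheory GRing.Theory Num.Theory.
Import numFieldNormedType.Exports.

Local Open Scope ring_scope.

(* A real Hilbert space: a complete normed module over the reals whose norm
   is the one induced by an inner product. With the involution [idfun], the
   type [{dot X for idfun}] is that of bilinear symmetric positive definite
   forms. *)
HB.mixin Record NormedModule_isHilbert (R : realType) X
    of NormedModule R X := {
  inner : {dot X for (idfun : R -> R)} ;
  norm_inner : forall x : X, `|x| = Num.sqrt (inner x x)
}.

#[short(type="hilbertType")]
HB.structure Definition Hilbert (R : realType) :=
  {X of NormedModule_isHilbert R X & CompleteNormedModule R X}.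

Definition cocoercive (R : realType) (X : hilbertType R) (beta : R)
    (A : X -> X) : Prop :=
  forall x y : X, inner (x - y) (A x - A y) >= beta * `|A x - A y| ^+ 2.

Definition Theta (R : realType) (beta L1 L2 L3 : R) : R :=
  (L1 + L2) *
  (L3 + (L1 + L2 + 2 * beta * L3
         + Num.sqrt (L1 ^+ 2 + L2 ^+ 2 + 2 * L1 * L2
                     + 8 * beta * L1 * L3 + 4 * beta * L2 * L3))
        / (2 * beta)).

(* Main.v *)
(** Put u = b - c and v = A b - A a. Cocoercivity gives
    <a - c, v> = <a - b, v> + <u, v> <= <u, v> - beta |v|^2, and expanding
    0 <= |u - 2 beta v|^2 bounds this by |u|^2 / (4 beta), hence by
    (L1 + L2)^2 / (4 beta). The other terms of Theta are nonnegative, so Theta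
    is at least (L1 + L2)^2 / (2 beta). *)
Require Import Defs.
From mathcomp Require Import all_boot all_order all_algebra.
From mathcomp Require Import all_classical all_reals topology normedtype.
From mathcomp Require Import lra sesquilinear.

Import Order.TTheory GRing.Theory Num.Theory.
Import numFieldNormedType.Exports.

Local Open Scope ring_scope.

Lemma inner_sym (R : realType) (X : hilbertType R) (u v : X) :
  inner u v = inner v u.
Proof. by rewrite [LHS]hermC /= expr0 mul1r. Qed.

Lemma innerxx (R : realType) (X : hilbertType R) (u : X) :
  inner u u = `|u| ^+ 2.
Proof.
rewrite norm_inner sqr_sqrtr//.
(* Positive definiteness speaks only of nonzero vectors, so 0 is treated apart. *)
have [->|u0] := eqVneq u 0; first by rewrite linear0l.
by rewrite ltW// neq0_dnorm_gt0.
Qed.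

Lemma inner_young (R : realType) (X : hilbertType R) (e : R) (u v : X) :
  2 * e * inner u v <= `|u| ^+ 2 + e ^+ 2 * `|v| ^+ 2.
Proof.
have : 0 <= inner (u - e *: v) (u - e *: v) by rewrite innerxx sqr_ge0.
rewrite linearBl !linearBr/= !linearZl !linearZr/= (inner_sym _ _ v u) !innerxx.
lra.
Qed.

Theorem proposition2p1 (R : realType) (X : hilbertType R)
    (beta L1 L2 L3 : R)
    (beta_gt0 : 0 < beta) (L1_gt0 : 0 < L1) (L2_gt0 : 0 < L2) (L3_gt0 : 0 < L3)
    (A : X -> X) (A_cocoercive : cocoercive beta A)
    (b c : X) (b_le : `|b| <= L1) (c_le : `|c| <= L2) (Ab_le : `|A b| <= L3)
    (a : X) :
  inner (a - c) (A b - A a) <= Theta beta L1 L2 L3.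
Proof.
have [beta_ge0 L1_ge0 L2_ge0 L3_ge0] :
  [/\ 0 <= beta, 0 <= L1, 0 <= L2 & 0 <= L3] by split; exact: ltW.
have bc_le : `|b - c| ^+ 2 <= (L1 + L2) ^+ 2.
  have bc1 : `|b - c| <= L1 + L2 by apply: le_trans (ler_normB _ _) (lerD _ _).
  by rewrite lerXn2r// nnegrE// addr_ge0.
have co := A_cocoercive b a.
(* The weight 2 beta makes the |v|^2 term match the one from cocoercivity. *)
have young := inner_young R X (2 * beta) (b - c) (A b - A a).
have -> : inner (a - c) (A b - A a)
    = inner (b - c) (A b - A a) - inner (b - a) (A b - A a).
  by rewrite -linearBl/= opprB [b - c + _]addrC addrA subrK.
have upper : inner (b - c) (A b - A a) - inner (b - a) (A b - A a)
    <= (L1 + L2) ^+ 2 / (2 * beta).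
  rewrite ler_pdivlMr ?mulr_gt0//.
  (* Half of [young] plus twice beta times [co] cancels |v|^2 and leaves (L1 + L2)^2 / 2;
     nonnegativity of the square gives away the spare factor 2. *)
  have := ler_wpM2l beta_ge0 co.
  have := sqr_ge0 (L1 + L2).
  lra.
(* After one factor L1 + L2 is cancelled, L3 is dropped, then 2 beta L3 and the root in the
   numerator. *)
apply: (le_trans upper); rewrite /Theta expr2 -mulrA.
rewrite ler_wpM2l ?addr_ge0// ler_wpDl// ler_wpM2r ?invr_ge0 ?mulr_ge0//.
by rewrite -addrA lerDl addr_ge0 ?sqrtr_ge0// !mulr_ge0.
Qed.
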